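(* Let $F$ satisfy axiom (viii), let $R\in\bar S$, and let the upper norm-limit of $g(I)$ over $R$ with respect to $G$ be finite. Then given $\varepsilon>0$ there is a $\delta>0$ such that, if $D\in G$ is a division of $R$ formed of $I_1,\dots,I_n$ with norm$(D)<\delta$, then for each $s=1,2,\dots,n$, $$\sum_{i=1}^{s}(N;G)\overline{\int}_{I_i} g(I)+\sum_{i=s+1}^{n}g(I_i)<(N;G)\overline{\int}_{R} g(I)+\varepsilon .$$ Similarly for lower norm-limits: if the lower norm-limit over $R$ is finite, then given $\varepsilon>0$ there is a $\delta>0$ such that for such $D$ with norm$(D)<\delta$ and each $s$, $\sum_{i=1}^{s}(N;G)\underline{\int}_{I_i} g(I)+\sum_{i=s+1}^{n}g(I_i)>(N;G)\underline{\int}_{R} g(I)-\varepsilon$.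
   Context: Fix real $A<B$ and $W=[A,B]$. An interval is any of $(a,b),[a,b),(a,b],[a,b]$ with $A\le a<b\le B$; its length is $mI=b-a$. Two intervals (or sets) overlap if they have a non-degenerate interval in common. An $I^\sigma$ is a finite union of intervals. $E'$ is the derived set of $E$. $S$ is a fixed non-empty set of intervals and $g:S\to\mathbb R$. $\bar S$ is the collection of all $I^\sigma$ which are finite unions of points of $W$ and interiors of intervals of $S$. A division $D$ of an $I^\sigma$ $R$ is a finite set of pairwise non-overlapping intervals of $S$ (each with its own end-point brackets), the union of whose closures is $R'$; norm$(D)$ is the greatest length of its intervals; $(R;D)\sum g(I)$ is the sum of $g(I)$ over the intervals of $D$. A Riemann succession of divisions of $R$ is a sequence $\{D_n\}$ of divisions of $R$ with norm$(D_n)\to0$. $D^{(1)}+D^{(2)}$ is the division formed by all the intervals of the divisions $D^{(1)},D^{(2)}$ of two non-overlapping sets. $F$ is a family of Riemann successions of divisions of sets $R\in\bar S$ satisfying: (i) for every $R\in\bar S$ there is at least one Riemann succession of divisions of $R$ in $F$; (ii) if $\{D_n\}\in F$ and $n_i\to\infty$ are integers, then $\{D_{n_i}\}\in F$; (iii) if $R_1,R_2\in\bar S$ are non-overlapping and $\{D_{1,n}\},\{D_{2,n}\}\in F$ are over $R_1,R_2$, then $\{D_{1,n}+D_{2,n}\}\in F$. $G$ is the set of all divisions occurring in successions of $F$. Axiom (viii): if $I\in S$, the division of $I$ consisting of $I$ alone is in $G$. The upper norm-limit over $R\in\bar S$ (a value in $[-\infty,\infty]$) is $(N;G)\overline{\int}_R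 g=\lim_{e\to0}\sup\{(R;D)\sum g(I): D\in G \text{ a division of }R,\ \mathrm{norm}(D)<e\}$; the lower norm-limit $(N;G)\underline{\int}_R g$ is the same with $\inf$. (Under the hypotheses no upper norm-limit over an $I_i$ is $+\infty$; a value $-\infty$ makes the first inequality trivially true, and dually for lower norm-limits.) *)

(* Defs.v *)
From HB Require Import structures.
From mathcomp Require Import all_boot all_order all_algebra finmap.
From mathcomp Require Import all_classical all_reals all_analysis.

Set Implicit Arguments.
Unset Strict Implicit.
Unset Printing Implicit Defensive.

Import Order.TTheory GRing.Theory Num.Theory.
Import numFieldNormedType.Exports.

Local Open Scope classical_set_scope.
Local Open Scope ring_scope.

(* [(a, b)], [[a, b)], [(a, b]] and [[a, b]] are the four terms
   [Interval (BSide bl a) (BSide br b)]. *)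
Definition isInterval (R : realType) (A B : R) (I : interval R) : Prop :=
  exists (bl br : bool) (a b : R),
    [/\ I = Interval (BSide bl a) (BSide br b), A <= a, a < b & b <= B].

(* The value [0] on unbounded intervals is junk: [isInterval] excludes them. *)
Definition mI (R : realType) (I : interval R) : R :=
  if I is Interval (BSide _ a) (BSide _ b) then b - a else 0.

Definition overlap (R : realType) (A B : R) (X Y : set R) : Prop :=
  exists2 J, isInterval A B J & [set` J] `<=` X `&` Y.

(* The union is of at least one interval, so an I^sigma is not empty. *)
Definition Isigma (R : realType) (A B : R) (X : set R) : Prop :=
  exists Js : {fset interval R},
    [/\ Js != fset0,
        forall J, J \in Js -> isInterval A B J
      & X = \bigcup_(J in [set` Js]) [set` J]].

Definition Sbar (R : realType) (A B : R) (S : set (interval R)) : set (set R) :=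
  [set X | Isigma A B X /\
    exists (P : {fset R}) (Js : {fset interval R}),
      [/\ [set` P] `<=` `[A, B],
          [set` Js] `<=` S
        & X = [set` P] `|` \bigcup_(J in [set` Js]) [set` J]°]].

(* [limit_point X] is the derived set of [X]. *)
Definition isDivision (R : realType) (A B : R) (S : set (interval R))
    (X : set R) (D : {fset interval R}) : Prop :=
  [/\ forall I, I \in D -> S I,
      forall I J, I \in D -> J \in D -> I != J ->
        ~ overlap A B [set` I] [set` J]
    & \bigcup_(I in [set` D]) closure [set` I] = limit_point X].

Definition norm (R : realType) (D : {fset interval R}) : R :=
  \big[Order.max/0]_(I <- D) mI I.

Definition isRiemannSuccession (R : realType) (A B : R) (S : set (interval R))
    (X : set R) (Ds : nat -> {fset interval R}) : Prop :=
  (forall n, isDivision A B S X (Ds n)) /\ norm (Ds n) @[n --> \oo] --> (0 : R).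

Record isFamily (R : realType) (A B : R) (S : set (interval R))
    (F : set (nat -> {fset interval R})) : Prop := IsFamily {
  family_over : forall Ds, F Ds ->
    exists2 X, Sbar A B S X & isRiemannSuccession A B S X Ds ;
  family_exists : forall X, Sbar A B S X ->
    exists2 Ds, F Ds & isRiemannSuccession A B S X Ds ;
  (* [k] tends to infinity but need not be increasing. *)
  family_subseq : forall Ds (k : nat -> nat), F Ds ->
    k i @[i --> \oo] --> \oo -> F (fun i => Ds (k i)) ;
  family_add : forall X1 X2 Ds1 Ds2,
    Sbar A B S X1 -> Sbar A B S X2 -> ~ overlap A B X1 X2 ->
    F Ds1 -> isRiemannSuccession A B S X1 Ds1 ->
    F Ds2 -> isRiemannSuccession A B S X2 Ds2 ->
    F (fun n => (Ds1 n `|` Ds2 n)%fset)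
}.

Definition divisionsOf (R : realType) (F : set (nat -> {fset interval R})) :
    set {fset interval R} :=
  [set D | exists Ds n, F Ds /\ D = Ds n].

Definition containsSingletons (R : realType) (S : set (interval R))
    (F : set (nat -> {fset interval R})) : Prop :=
  forall I, S I -> divisionsOf F [fset I]%fset.

Definition normSums (R : realType) (A B : R) (S : set (interval R))
    (G : set {fset interval R}) (g : interval R -> R) (X : set R) (e : R) :
    set (\bar R) :=
  [set (\sum_(I <- D) g I)%:E | D in
     [set D | [/\ G D, isDivision A B S X D & norm D < e]]].

Definition upperNormLimit (R : realType) (A B : R) (S : set (interval R))
    (G : set {fset interval R}) (g : interval R -> R) (X : set R) : \bar R :=
  lim (ereal_sup (normSums A B S G g X e) @[e --> 0^'+]).

Definition lowerNormLimit (R : realType) (A B : R) (S : set (interval R))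
    (G : set {fset interval R}) (g : interval R -> R) (X : set R) : \bar R :=
  lim (ereal_inf (normSums A B S G g X e) @[e --> 0^'+]).

(* Main.v *)
Require Import Defs.
From HB Require Import structures.
From mathcomp Require Import all_boot all_order all_algebra finmap lra.
From mathcomp Require Import all_classical all_reals all_analysis.

Set Implicit Arguments.
Unset Strict Implicit.
Unset Printing Implicit Defensive.

Import Order.TTheory GRing.Theory Num.Theory.
Import DualAddTheory numFieldNormedType.Exports.

Local Open Scope classical_set_scope.
Local Open Scope ring_scope.

(** The upper norm-limit over [X] is the infimum over [e > 0] of the supremum
    of the sums over divisions of norm less than [e]
    ([upperNormLimit_inf]).  As it is finite, some [delta] makes that supremum
    less than the norm-limit plus [eps].  Let [D] be a division of [X] in [G]
    of norm less than [delta].  Replace each selected interval [I] of [D] by a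
    division of [I] in [G], again of norm less than [delta], and keep the other
    intervals, each being a division of itself in [G] ([containsSingletons]).  The
    pieces combine to one division of [X] in [G] of norm less than [delta]
    ([isDivision_bigfcup]), and no interval occurs in two pieces
    ([isDivision_disjoint]), so the sum of the sums over the pieces is at most
    the supremum for [delta].  The pieces vary independently, so this bound
    survives taking the supremum in each piece ([dsum_ereal_sup_le]), and for a
    selected interval [I] this supremum is at least the upper norm-limit over
    [I].  The result is [upper_replacement].

    [family_add] speaks of whole successions and of sets that do not overlap.
    Two divisions in [G] are brought to the same index by shifting their
    successions ([divisionsOf_head]), and an interval overlaps a finite union
    of intervals only if it overlaps one of them ([overlap_bigcup]), so the
    pieces can be added one at a time.

    Lower norm-limits of [g] are the opposites of the upper norm-limits of
    [- g] ([lowerNormLimitE]), and dual addition of extended reals is the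
    conjugate of addition by the opposite, so the second half is the first one
    for [- g]. *)

(** * Intervals, derived sets and overlapping *)

Lemma limit_pointU (R : realType) (X Y : set R) :
  limit_point (X `|` Y) = limit_point X `|` limit_point Y.
Proof.
apply/seteqP; split=> [x XYx|x []]; last 2 first.
- by move=> Xx U /Xx[y [yx Xy Uy]]; exists y; split=> //; left.
- by move=> Yx U /Yx[y [yx Yy Uy]]; exists y; split=> //; right.
have [Xx|] := pselect (limit_point X x); first by left.
rewrite not_limit_pointE => -[V xV XV]; right => U xU.
have [y [yx [Xy|Yy] [Uy Vy]]] := XYx _ (filterI xU xV); last by exists y.
by move: yx; rewrite (XV y)// eqxx.
Qed.

Lemma interval_subset_cc (R : realType) (bl br : bool) (a b : R) :
  [set` Interval (BSide bl a) (BSide br b)] `<=` `[a, b]%classic.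
Proof. by apply: subset_itv; rewrite bnd_simp; case: bl; case: br. Qed.

Lemma oo_subset_interval (R : realType) (bl br : bool) (a b : R) :
  `]a, b[%classic `<=` [set` Interval (BSide bl a) (BSide br b)].
Proof. by apply: subset_itv; case: bl; case: br; rewrite bnd_simp. Qed.

(** A non-degenerate interval has no isolated point: near a point of its
    closure lie points of its interior, towards the midpoint. *)
Lemma limit_point_interval (R : realType) (A B : R) (I : interval R) :
  isInterval A B I -> limit_point [set` I] = closure [set` I].
Proof.
move=> [bl [br [a [b [-> _ ab _]]]]].
apply/seteqP; split; first exact: subset_limit_point.
move=> t /(closureS (@interval_subset_cc _ _ _ _ _))/itv_closed.
rewrite /= in_itv/= => /andP[ta tb] U.
rewrite -nbhs_ballE => -[r /= r0 rU].
suff [y [yt aby /rU Uy]] : exists y, [/\ y != t, a < y < b & ball t r y].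
  by exists y; split => //; apply: oo_subset_interval; rewrite /= in_itv.
move: tb; rewrite le_eqVlt => /predU1P[->|tb].
  exists (Num.max (b - r / 2) ((a + b) / 2)).
  by rewrite /ball/=; case: (leP (b - r / 2)) => h; split;
    rewrite ?lt_eqF ?ltr_norml//; lra.
exists (Num.min (t + r / 2) ((t + b) / 2)).
by rewrite /ball/=; case: (leP (t + r / 2)) => h; split;
  rewrite ?gt_eqF ?ltr_norml//; lra.
Qed.

(** Passing to the closure adds only end-points, which are not interior. *)
Lemma open_sub_interval (R : realType) (A B : R) (I : interval R) (U : set R) :
  isInterval A B I -> open U -> U `<=` closure [set` I] -> U `<=` [set` I].
Proof.
move=> [bl [br [a [b [-> _ ab _]]]]] oU UI.
apply: subset_trans (@oo_subset_interval R bl br a b).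
rewrite -(interior_itv_bnd a b true false); rewrite -open_subsetE//.
apply: subset_trans UI _ => x.
by move=> /(closureS (@interval_subset_cc _ _ _ _ _))/itv_closed.
Qed.

Lemma infinite_interval (R : realType) (A B : R) (I : interval R) :
  isInterval A B I -> infinite_set [set` I].
Proof.
move=> II; have [bl [br [a [b [Iab _ ab _]]]]] := II.
have : limit_point [set` I] ((a + b) / 2).
  rewrite (limit_point_interval II) Iab; apply/subset_closure/oo_subset_interval.
  by rewrite /= in_itv/=; lra.
by move/limit_point_infinite_setP => /(_ setT filterT); rewrite setTI.
Qed.

(** Two distinct points of [I] and [J] span a closed interval contained in
    both, as intervals are convex. *)
Lemma infinite_overlap (R : realType) (A B : R) (I J : interval R) (Y : set R) :
  isInterval A B J -> [set` J] `<=` Y -> infinite_set ([set` J] `&` [set` I]) ->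
  overlap A B [set` I] Y.
Proof.
move=> [bl [br [a [b [Jab Aa ab bB]]]]] JY infJI.
have [x [Jx Ix]] := infinite_setN0 infJI.
have [y [[Jy Iy] yx]] := infinite_setN0 (infinite_setD infJI (finite_set1 x)).
wlog xy : x y Jx Ix Jy Iy yx / x < y => [wlg|].
  have /orP[xy|xy] : (x < y) || (y < x) by rewrite -neq_lt eq_sym; exact/eqP.
  - exact: (wlg x y).
  - by apply: (wlg y x) => //= /esym.
have bd z : [set` J] z -> A <= z <= B.
  by rewrite Jab => /interval_subset_cc; rewrite /= in_itv/=; lra.
exists `[x, y].
  by exists true, false, x, y; split => //; [move/bd: Jx|move/bd: Jy]; lra.
move=> z; rewrite /= in_itv/= => xzy.
by split; [|apply: JY]; exact: interval_is_interval xzy.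
Qed.

(** An interval [J] inside a finite union is infinite, so it meets one member
    of the union in infinitely many points. *)
Lemma overlap_bigcup (R : realType) (A B : R) (r : seq (interval R)) (Y : set R) :
  overlap A B (\bigcup_(I in [set` r]) [set` I]) Y ->
  exists2 I, I \in r & overlap A B [set` I] Y.
Proof.
move=> [J JJ]; rewrite subsetI => -[JX JY].
apply: contrapT => nov; apply: (infinite_interval JJ).
rewrite -(setIidl JX) setI_bigcupr; apply: bigcup_finite; first exact: finite_seq.
move=> I /= Ir; apply: contrapT => infI; apply: nov; exists I => //.
exact: infinite_overlap infI.
Qed.

(** * Divisions occurring in the family *)

(** An interval is its interior together with those of its end-points that
    belong to it. *)
Lemma Sbar_interval (R : realType) (A B : R) (S : set (interval R)) I :
  isInterval A B I -> S I -> Sbar A B S [set` I].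
Proof.
move=> II SI; split.
  exists [fset I]%fset; split.
  - by apply/fset0Pn; exists I; rewrite inE.
  - by move=> J; rewrite inE => /eqP ->.
  - by rewrite set_fset1 bigcup_set1.
have [bl [br [a [b [Iab Aa ab bB]]]]] := II.
exists [fset x in [:: a; b] | x \in I]%fset, [fset I]%fset; split.
- move=> x; rewrite /= in_itv/= !inE => /andP[/orP[]/eqP-> _]; lra.
- by move=> J; rewrite /= inE => /eqP->.
rewrite set_fset1 bigcup_set1; apply/seteqP; split=> x; last first.
  by case=> [|/interior_subset//]; rewrite /= !inE => /andP[].
move=> Ix; have := Ix; rewrite {1}Iab => /interval_subset_cc.
rewrite /= in_itv/= => /andP[ax xb].
have [xab|] := boolP (x \in [:: a; b]).
  by left; apply/imfsetP; exists x => //; apply/andP.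
rewrite !inE negb_or => /andP[xa xb']; right.
by rewrite Iab interior_itv_bnd /= in_itv/= !lt_neqAle eq_sym xa ax xb' xb.
Qed.

Lemma SbarU (R : realType) (A B : R) (S : set (interval R)) (X Y : set R) :
  Sbar A B S X -> Sbar A B S Y -> Sbar A B S (X `|` Y).
Proof.
move=> [[JX [JX0 JXI eX]] [PX [KX [PXW KXS eX']]]].
move=> [[JY [JY0 JYI eY]] [PY [KY [PYW KYS eY']]]]; split.
  exists (JX `|` JY)%fset; split.
  - by have /fset0Pn[J JJX] := JX0; apply/fset0Pn; exists J; rewrite inE JJX.
  - by move=> J; rewrite inE => /orP[/JXI|/JYI].
  - by rewrite set_fsetU bigcup_setU -eX -eY.
exists (PX `|` PY)%fset, (KX `|` KY)%fset; split.
- by rewrite set_fsetU subUset.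
- by rewrite set_fsetU subUset.
- by rewrite !set_fsetU bigcup_setU setUACA -eX' -eY'.
Qed.

Lemma norm_ltP (R : realType) (D : {fset interval R}) (e : R) :
  norm D < e <-> 0 < e /\ forall I, I \in D -> mI I < e.
Proof.
rewrite /norm; split; last first.
  by move=> [e0 De]; rewrite big_seq_cond; apply: bigmax_lt => // I /andP[/De].
suff h (r : seq (interval R)) : \big[Num.max/0]_(I <- r) mI I < e ->
    0 < e /\ forall I, I \in r -> mI I < e by exact: h.
elim: r => [|J r IHr]; first by rewrite big_nil => e0; split.
rewrite big_cons gt_max => /andP[Je /IHr[e0 re]]; split => // I.
by rewrite inE => /predU1P[->//|/re].
Qed.

(** Dropping the terms before [D] leaves a succession of [F] ([family_subseq]).
    The set that [F] assigns to it may differ from [X], but it has the same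
    derived set, since both are divided by [D]; and being a division of a set
    depends only on its derived set. *)
Lemma divisionsOf_head (R : realType) (A B : R) (S : set (interval R)) F X D :
  isFamily A B S F -> divisionsOf F D -> isDivision A B S X D ->
  exists2 Ds, F Ds & isRiemannSuccession A B S X Ds /\ Ds 0 = D.
Proof.
move=> FF [Ds [n [FDs ->]]] XDn.
have FDs' : F (fun i => Ds (i + n)%N).
  by apply: (family_subseq FF) => //; exact: cvg_addnr.
exists (fun i => Ds (i + n)%N) => //; split => //.
have [Y _ [YD normD]] := family_over FF FDs'.
split => // i; have [DS Dov DY] := YD i; split => //.
by have [_ _ <-] := XDn; have [_ _ ] := YD 0%N; rewrite add0n => ->.
Qed.

Lemma isDivision_singleton (R : realType) (A B : R) (S : set (interval R)) I :
  isInterval A B I -> S I -> isDivision A B S [set` I] [fset I]%fset.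
Proof.
move=> II SI; split.
- by move=> J; rewrite inE => /eqP->.
- by move=> J K; rewrite !inE => /eqP-> /eqP->; rewrite eqxx.
- by rewrite set_fset1 bigcup_set1 (limit_point_interval II).
Qed.

(** By [family_add] the union belongs to a succession of [F], which is already
    known to consist of divisions of some set; so the intervals of the union
    lie in [S] and do not overlap, and only the derived set must be
    computed. *)
Lemma isDivisionU (R : realType) (A B : R) (S : set (interval R)) F X1 X2 D1 D2 :
  isFamily A B S F -> Sbar A B S X1 -> Sbar A B S X2 -> ~ overlap A B X1 X2 ->
  divisionsOf F D1 -> isDivision A B S X1 D1 ->
  divisionsOf F D2 -> isDivision A B S X2 D2 ->
  divisionsOf F (D1 `|` D2)%fset /\
  isDivision A B S (X1 `|` X2) (D1 `|` D2)%fset.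
Proof.
move=> FF SX1 SX2 nov GD1 X1D1 GD2 X2D2.
have [Ds1 FDs1 [RS1 D10]] := divisionsOf_head FF GD1 X1D1.
have [Ds2 FDs2 [RS2 D20]] := divisionsOf_head FF GD2 X2D2.
have FU := family_add FF SX1 SX2 nov FDs1 RS1 FDs2 RS2.
split; first by exists (fun n => (Ds1 n `|` Ds2 n)%fset), 0%N; rewrite D10 D20.
have [Y _ [/(_ 0%N) []]] := family_over FF FU.
rewrite D10 D20 => US Uov _ _; split => //.
rewrite set_fsetU bigcup_setU limit_pointU.
by have [_ _ ->] := X1D1; have [_ _ ->] := X2D2.
Qed.

(** Iterating [isDivisionU] over non-overlapping intervals.  Membership of the
    union in [Sbar] is carried along because the next addition needs it. *)
Lemma isDivision_bigfcup (R : realType) (A B : R) (S : set (interval R)) F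
    (r : seq (interval R)) (E : interval R -> {fset interval R}) :
  S `<=` isInterval A B -> isFamily A B S F ->
  r != [::] -> uniq r -> (forall I, I \in r -> S I) ->
  (forall I J, I \in r -> J \in r -> I != J ->
     ~ overlap A B [set` I] [set` J]) ->
  (forall I, I \in r -> divisionsOf F (E I) /\ isDivision A B S [set` I] (E I)) ->
  [/\ Sbar A B S (\bigcup_(I in [set` r]) [set` I]),
      divisionsOf F (\bigcup_(I <- r) E I)%fset &
      isDivision A B S (\bigcup_(I in [set` r]) [set` I])
        (\bigcup_(I <- r) E I)%fset].
Proof.
move=> SI FF; elim: r => [//|I [|J r] IHr] _;
  rewrite cons_uniq => /andP[Ir ur] rS nov rE.
  have [|GE IE] := rE I; first by rewrite inE.
  have SII : S I by apply: rS; rewrite inE.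
  rewrite big_seq1 set_cons1 bigcup_set1.
  by split => //; apply: Sbar_interval => //; exact: SI.
have sub K : K \in J :: r -> K \in [:: I, J & r] by move=> h; rewrite inE h orbT.
have [SU GU UU] := IHr isT ur (fun K Kr => rS K (sub K Kr))
  (fun K L Kr Lr => nov K L (sub K Kr) (sub L Lr)) (fun K Kr => rE K (sub K Kr)).
have [|GE IE] := rE I; first by rewrite inE eqxx.
have SII : S I by apply: rS; rewrite inE eqxx.
have SbI : Sbar A B S [set` I] by apply: Sbar_interval => //; exact: SI.
have -> : [set` [:: I, J & r]] = [set` J :: r] `|` [set I].
  apply/seteqP; split=> K.
    by move=> /predU1P[->|]; [right|left].
  by case=> [Kr|->]; [exact: sub|exact: mem_head].
rewrite big_cons fsetUC bigcup_setU bigcup_set1.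
have [|GUE UUE] := isDivisionU FF SU SbI _ GU UU GE IE; last first.
  by split => //; exact: SbarU.
move=> /overlap_bigcup[K Kr].
apply: nov; [exact: sub|by rewrite inE eqxx|].
by apply: contraNneq Ir => <-.
Qed.

(** A common interval would have its interior in the closures of [I] and of
    [J], hence in [I] and in [J]. *)
Lemma isDivision_disjoint (R : realType) (A B : R) (S : set (interval R))
    (I J : interval R) (D E : {fset interval R}) :
  S `<=` isInterval A B -> S I -> S J -> ~ overlap A B [set` I] [set` J] ->
  isDivision A B S [set` I] D -> isDivision A B S [set` J] E ->
  [disjoint D & E]%fset.
Proof.
move=> SI /SI II /SI IJ nov [DS _ DI] [_ _ EJ].
apply/fdisjointP => K KD; apply/negP => KE; apply: nov.
have [bl [br [a [b [Kab Aa ab bB]]]]] := SI _ (DS _ KD).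
have cK (L : interval R) (C : {fset interval R}) : isInterval A B L -> K \in C ->
    \bigcup_(M in [set` C]) closure [set` M] = limit_point [set` L] ->
    `]a, b[%classic `<=` [set` L].
  move=> LL KC CL; apply: (open_sub_interval LL); first exact: interval_open.
  apply: subset_trans (@subset_limit_point _ _); rewrite -CL.
  move=> x abx; exists K => //; apply: subset_closure.
  by rewrite Kab; exact: oo_subset_interval.
exists `]a, b[; first by exists false, true, a, b.
by rewrite subsetI; split; [exact: cK DI|exact: cK EJ].
Qed.

(** * Norm-limits and sums of suprema *)

(** The supremum is nondecreasing in [e], so its limit at [0] from the right
    exists and is the infimum. *)
Lemma upperNormLimit_inf (R : realType) (A B : R) (S : set (interval R)) G g X :
  upperNormLimit A B S G g X =
  ereal_inf [set ereal_sup (normSums A B S G g X e) | e in `]0, +oo[%classic].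
Proof.
apply/cvg_lim => //; apply: (nondecreasing_at_right_cvge +oo%O) => //.
move=> e e' _ _ ee'; apply: le_ereal_sup => _ [D [GD XD De] <-].
by exists D => //; split => //; exact: lt_le_trans ee'.
Qed.

Lemma lowerNormLimitE (R : realType) (A B : R) (S : set (interval R)) G g X :
  lowerNormLimit A B S G g X =
  (- upperNormLimit A B S G (fun I => - g I)%R X)%E.
Proof.
have supN e : ereal_inf (normSums A B S G g X e) =
    (- ereal_sup (normSums A B S G (fun I => - g I)%R X e))%E.
  rewrite /ereal_inf /normSums image_comp; congr (- ereal_sup _)%E.
  by apply: eq_imagel => D _ /=; rewrite sumrN.
rewrite /lowerNormLimit /upperNormLimit; under eq_fun do rewrite supN.
rewrite -limeN//; apply: nondecreasing_at_right_is_cvge.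
near=> x => e e' _ _ ee'; apply: le_ereal_sup => _ [D [GD XD De] <-].
by exists D => //; split => //; exact: lt_le_trans ee'.
Unshelve. all: by end_near. Qed.

(** A bound on all sums of independent choices bounds the sum of the suprema.
    Fixing all choices but one bounds each [C x], so the suprema are real;
    this also rules out [+oo], which would absorb everything in the dual
    sum. *)
Lemma dsum_ereal_sup_le (R : realType) (T : eqType) (r : seq T)
    (C : T -> set R) (M : \bar R) :
  uniq r -> (forall x, x \in r -> C x !=set0) ->
  (forall t : T -> R, (forall x, x \in r -> C x (t x)) ->
     ((\sum_(x <- r) t x)%:E <= M)%E) ->
  ((\sum_(x <- r) ereal_sup (EFin @` C x))%dE <= M)%E.
Proof.
move=> ur C0 CM.
have [t0 t0C] : exists t0 : T -> R, forall x, x \in r -> C x (t0 x).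
  have /choice[t0 t0C] x : exists y, x \in r -> C x y.
    by have [/C0[y Cy]|_] := boolP (x \in r); [exists y|exists 0].
  by exists t0.
case: M CM => [M|_|CM]; [|exact: leey|by have := CM _ t0C].
move=> CM.
have supC x : x \in r -> has_sup (C x).
  move=> xr; split; first exact: C0.
  exists (M - \sum_(y <- r | y != x) t0 y) => z Cz; rewrite lerBrDr.
  pose t y := if y == x then z else t0 y.
  have tx : t x = z by rewrite /t eqxx.
  have := CM t; rewrite lee_fin (bigD1_seq x)//= tx.
  rewrite (eq_bigr t0) => [|y /negPf yx]; last by rewrite /t yx.
  by apply=> y yr; rewrite /t; case: eqP => [->//|_]; exact: t0C.
rewrite big_seq (eq_bigr (fun x => (sup (C x))%:E)) => [|x xr]; last first.
  by rewrite ereal_sup_EFin //; [case: (supC x xr)|exact: C0].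
rewrite -big_seq dsumEFin lee_fin; apply/ler_addgt0Pr => e e0.
(* There are [size r] errors; the successor avoids dividing by [0]. *)
pose eta := e / (size r).+1%:R.
have eta0 : 0 < eta by rewrite divr_gt0.
have /choice[t tC] x : exists y, x \in r -> C x y /\ sup (C x) <= y + eta.
  have [xr|_] := boolP (x \in r); last by exists 0.
  have [y Cy ylt] := sup_adherent eta0 (supC x xr).
  by exists y => _; split => //; rewrite -lerBlDr ltW.
apply: (@le_trans _ _ (\sum_(x <- r) (t x + eta))).
  by rewrite big_seq [leRHS]big_seq; apply: ler_sum => x /tC[].
rewrite big_split/= big_const_seq count_predT iter_addr_0 lerD//.
  by rewrite -lee_fin; apply: CM => x /tC[].
rewrite -[leLHS]mulr_natr mulrAC ler_pdivrMr// ler_pM2l// ler_nat.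
exact: leqnSn.
Qed.

(** * Replacing intervals of a division *)

(** The selected intervals form an arbitrary part [P] of the division, so that
    no enumeration enters the argument. *)
Lemma upper_replacement (R : realType) (A B : R) (S : set (interval R))
    (g : interval R -> R) (F : set (nat -> {fset interval R})) (X : set R) :
  S `<=` isInterval A B -> isFamily A B S F -> containsSingletons S F ->
  upperNormLimit A B S (divisionsOf F) g X \is a fin_num ->
  forall eps : R, 0 < eps -> exists2 delta : R, 0 < delta &
  forall (D : {fset interval R}) (P : pred (interval R)),
    divisionsOf F D -> isDivision A B S X D -> D != fset0 ->
    norm D < delta ->
    ((\sum_(I <- D | P I) upperNormLimit A B S (divisionsOf F) g [set` I]
       + (\sum_(I <- D | ~~ P I) g I)%R%:E)%dE
     < upperNormLimit A B S (divisionsOf F) g X + eps%:E)%E.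
Proof.
move=> SI FF sF finU eps eps0.
set G := divisionsOf F; set U := upperNormLimit A B S G g.
have : (ereal_inf [set ereal_sup (normSums A B S G g X e) |
    e in `]0%R, +oo[%classic] < U X + eps%:E)%E.
  by rewrite -upperNormLimit_inf lteDl ?lte_fin.
move=> /ereal_inf_lt[_ [delta + <-] supU]; rewrite /= in_itv/= andbT => delta0.
exists delta => // D P GD XD D0 Ddelta; apply: le_lt_trans supU.
have [DS Dov DX] := XD.
(* The admissible pieces: any fine division of [J] if [J] is selected, only
   [J] itself otherwise. *)
pose divs J := [set E | [/\ G E, isDivision A B S [set` J] E, norm E < delta &
  P J \/ E = [fset J]%fset]].
have divs1 J : J \in D -> divs J [fset J]%fset.
  move=> JD; have SJ := DS _ JD; split; first exact: sF.
  - by apply: isDivision_singleton => //; exact: SI.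
  - have [_ mD] := (norm_ltP _ _).1 Ddelta; apply/norm_ltP; split => // K.
    by rewrite inE => /eqP->; exact: mD.
  - by right.
pose C J := [set \sum_(I <- (E : {fset interval R})) g I | E in divs J].
have CM t : (forall J, J \in D -> C J (t J)) ->
    ((\sum_(J <- D) t J)%:E <= ereal_sup (normSums A B S G g X delta))%E.
  move=> tC.
  have /choice[E DE] J : exists E, J \in D ->
      divs J E /\ \sum_(I <- (E : {fset interval R})) g I = t J.
    have [/tC[E JE Et]|_] := boolP (J \in D); [by exists E|by exists fset0].
  have ext (E' : interval R -> {fset interval R}) :
      (forall J, J \in D -> divs J (E' J)) ->
      [/\ Sbar A B S (\bigcup_(I in [set` D]) [set` I]),
      G (\bigcup_(I <- D) E' I)%fset &
      isDivision A B S (\bigcup_(I in [set` D]) [set` I])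
        (\bigcup_(I <- D) E' I)%fset].
    move=> E'P; apply: isDivision_bigfcup => //; last by move=> I /E'P[].
    exact: fset_uniq.
  have [_ GE [ES Eov EX]] := ext E (fun J JD => (DE J JD).1).
  (* Combining the trivial pieces gives [D] itself as a division of the union
     of its intervals, which thus has the derived set of [X]. *)
  have [_ _ [_ _ ]] := ext (fun J => [fset J]%fset) divs1.
  have -> : (\bigcup_(I <- D) [fset I])%fset = D.
    apply/fsetP => J; apply/bigfcupP/idP => [[K]|JD].
      by rewrite andbT inE => KD /eqP->.
    by exists J; rewrite ?JD ?inE.
  rewrite DX => XX.
  apply: ereal_sup_ubound; exists (\bigcup_(I <- D) E I)%fset.
    split => //; first by split => //; rewrite EX XX.
    apply/norm_ltP; split => // K /bigfcupP[J /andP[JD _] KE].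
    by have [[_ _ /norm_ltP[_ mE] _] _] := DE _ JD; exact: mE.
  congr EFin; rewrite partition_disjoint_bigfcup/=.
    by rewrite big_seq [RHS]big_seq; apply: eq_bigr => J /DE[].
  move=> I J ID JD IJ; have [[_ IE _ _] _] := DE _ ID.
  have [[_ JE _ _] _] := DE _ JD.
  by apply: (isDivision_disjoint SI _ _ _ IE JE); [exact: DS|exact: DS|exact: Dov].
apply: (@le_trans _ _ (\sum_(J <- D) ereal_sup (EFin @` C J))%dE); last first.
  apply: dsum_ereal_sup_le => // J JD.
  by exists (\sum_(I <- [fset J]%fset) g I), [fset J]%fset => //; exact: divs1.
rewrite [leRHS](bigID P)/= -dsumEFin; apply: lee_dD.
  rewrite big_seq_cond [leRHS]big_seq_cond; apply: lee_dsum => J /andP[JD PJ].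
  rewrite /U upperNormLimit_inf; apply: ge_ereal_inf.
  exists (ereal_sup (normSums A B S G g [set` J] delta)).
    by exists delta => //; rewrite /= in_itv/= delta0.
  apply: le_ereal_sup => _ [E [GE JE Ed] <-].
  by exists (\sum_(I <- E) g I) => //; exists E => //; split => //; left.
rewrite big_seq_cond [leRHS]big_seq_cond; apply: lee_dsum => J /andP[JD PJ].
apply: ereal_sup_ubound; exists (g J) => //.
by exists [fset J]%fset; [exact: divs1|rewrite big_seq_fset1].
Qed.

Lemma big_fset_enumeration (V : Type) (idx : V) (op : Monoid.com_law idx)
    (T : choiceType) (n : nat) (I : 'I_n -> T) (P : pred T) (f : T -> V) :
  injective I ->
  \big[op/idx]_(J <- [fset I i | i in 'I_n]%fset | P J) f J =
  \big[op/idx]_(i < n | P (I i)) f (I i).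
Proof.
move=> injI; rewrite big_mkcond big_imfset/=; last by move=> i j _ _ /injI.
by rewrite -big_mkcond/= big_enum_cond; apply: eq_bigl => i; rewrite inE.
Qed.

Lemma upper_replacement_enumerated (R : realType) (A B : R) (S : set (interval R))
    (g : interval R -> R) (F : set (nat -> {fset interval R})) (X : set R) :
  S `<=` isInterval A B -> isFamily A B S F -> containsSingletons S F ->
  upperNormLimit A B S (divisionsOf F) g X \is a fin_num ->
  forall eps : R, 0 < eps -> exists2 delta : R, 0 < delta &
  forall (D : {fset interval R}) (n : nat) (I : 'I_n -> interval R),
     divisionsOf F D -> isDivision A B S X D ->
     injective I -> D = [fset I i | i in 'I_n]%fset ->
     norm D < delta ->
     forall s : nat, (1 <= s <= n)%N ->
     ((\sum_(i < n | (i < s)%N)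
          upperNormLimit A B S (divisionsOf F) g [set` I i]
       + (\sum_(i < n | (s <= i)%N) g (I i))%R%:E)%dE
     < upperNormLimit A B S (divisionsOf F) g X + eps%:E)%E.
Proof.
move=> SI FF sF finU eps eps0.
have [delta delta0 h] := upper_replacement SI FF sF finU eps0.
exists delta => // D n I GD XD injI eD Dd s /andP[s1 sn].
pose P J := [exists i : 'I_n, (i < s)%N && (I i == J)].
have PI i : P (I i) = (i < s)%N.
  apply/existsP/idP => [[j /andP[js /eqP/injI <-//]]|si].
  by exists i; rewrite si eqxx.
have NPI i : ~~ P (I i) = (s <= i)%N by rewrite PI -leqNgt.
have D0 : D != fset0.
  apply/fset0Pn; exists (I (Ordinal (leq_trans s1 sn))).
  by rewrite eD; apply/imfsetP; exists (Ordinal (leq_trans s1 sn)).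
have := h D P GD XD D0 Dd.
rewrite eD !big_fset_enumeration//.
by rewrite (eq_bigl _ _ PI) (eq_bigl _ _ NPI).
Qed.

(* [I] enumerates the division [D] from index 0, so [i < s] selects the first
   [s] intervals.  Sums of norm-limits that would mix [+oo] and [-oo] take the
   value against the claim: [+oo] for the upper norm-limits (the dual addition,
   %dE), [-oo] for the lower ones (the usual addition, %E). *)
Theorem mainTheorem6 (R : realType) (A B : R) (S : set (interval R))
    (g : interval R -> R) (F : set (nat -> {fset interval R})) (X : set R) :
  A < B ->
  S !=set0 ->
  S `<=` isInterval A B ->
  isFamily A B S F ->
  containsSingletons S F ->
  Sbar A B S X ->
  (upperNormLimit A B S (divisionsOf F) g X \is a fin_num ->
   forall eps : R, 0 < eps ->
   exists2 delta : R, 0 < delta &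
   forall (D : {fset interval R}) (n : nat) (I : 'I_n -> interval R),
     divisionsOf F D -> isDivision A B S X D ->
     injective I -> D = [fset I i | i in 'I_n]%fset ->
     norm D < delta ->
     forall s : nat, (1 <= s <= n)%N ->
     ((\sum_(i < n | (i < s)%N)
          upperNormLimit A B S (divisionsOf F) g [set` I i]
       + (\sum_(i < n | (s <= i)%N) g (I i))%R%:E)%dE
     < upperNormLimit A B S (divisionsOf F) g X + eps%:E)%E) /\
  (lowerNormLimit A B S (divisionsOf F) g X \is a fin_num ->
   forall eps : R, 0 < eps ->
   exists2 delta : R, 0 < delta &
   forall (D : {fset interval R}) (n : nat) (I : 'I_n -> interval R),
     divisionsOf F D -> isDivision A B S X D ->
     injective I -> D = [fset I i | i in 'I_n]%fset ->
     norm D < delta ->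
     forall s : nat, (1 <= s <= n)%N ->
     (lowerNormLimit A B S (divisionsOf F) g X - eps%:E
     < \sum_(i < n | (i < s)%N)
          lowerNormLimit A B S (divisionsOf F) g [set` I i]
       + (\sum_(i < n | (s <= i)%N) g (I i))%R%:E)%E).
Proof.
move=> _ _ SI FF sF _; split; first exact: upper_replacement_enumerated.
rewrite lowerNormLimitE fin_numN => finU eps eps0.
have [delta delta0 h] := upper_replacement_enumerated SI FF sF finU eps0.
exists delta => // D n I GD XD injI eD Dd s sn.
have := h D n I GD XD injI eD Dd s sn.
rewrite dual_addeE dual_sumeE oppeK.
rewrite sumrN EFinN oppeK => hup.
under eq_bigr do rewrite lowerNormLimitE.
by rewrite -fin_num_oppeD// lteNl.
Qed.
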